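(* Let $M$ be a set of ultrafilters over some set $I$, let $A=\bigcup_{D\in M}D$, and let $X$ be a topological space. (a) $X$ is quasi $M$-compact if and only if, whenever $(O_a)_{a\in A}$ are open sets of $X$ such that, for every $D\in M$, $(O_a)_{a\in D}$ is a cover of $X$, then there is $i\in I$ such that $(O_a)_{i\in a\in A}$ is a cover of $X$. (b) $X$ is quasi $M$-pseudocompact if and only if, whenever $(O_a)_{a\in A}$ are open sets of $X$ such that, for every $D\in M$, $(O_a)_{a\in D}$ is a cover of $X$, then there is $i\in I$ such that $(O_a)_{i\in a\in A}$ is dense in $X$.
   Context: No separation axiom is assumed. The notation $(O_a)_{i\in a\in A}$ means the subfamily indexed by those $a\in A$ with $i\in a$; a family of subsets of $X$ is said to be dense in $X$ if its union is dense in $X$. For an ultrafilter $D$ over $I$, a sequence $(x_i)_{i\in I}$ of elements of $X$ $D$-converges to $x\in X$ if $\{i\in I\mid x_i\in U\}\in D$ for every neighborhood $U$ of $x$. A point $x\in X$ is a $D$-limit point of a sequence $(O_i)_{i\in I}$ of subsets of $X$ if $\{i\in I\mid O_i\cap U\neq\emptyset\}\in D$ for every open neighborhood $U$ of $x$. $X$ is quasi $M$-compact if, for every sequence $(x_i)_{i\in I}$ of elements of $X$, there exists $D\in M$ such that $(x_i)_{i\in I}$ $D$-converges to some point of $X$. $X$ is quasi $M$-pseudocompact if, for every sequence $(O_i)_{i\in I}$ of nonempty open sets of $X$, there exists $D\in M$ such that $(O_i)_{i\in I}$ has some $D$-limit point in $X$. *)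

(* Defs.v *)
From mathcomp Require Import all_boot all_order.
From mathcomp Require Import boolp classical_sets functions filter topology.

Set Implicit Arguments.
Unset Strict Implicit.
Unset Printing Implicit Defensive.

Local Open Scope classical_set_scope.

Definition Dlimit_point (X : topologicalType) (I : Type) (D : set_system I)
    (O : I -> set X) (x : X) : Prop :=
  forall U : set X, open U -> U x -> D [set i | O i `&` U !=set0].

(* [x_ @ D --> x] unfolds to: D contains [set i | U (x_ i)] for every
   neighborhood U of x, i.e. x_ D-converges to x. *)
Definition quasi_compact (I : Type) (M : set (set_system I))
    (X : topologicalType) : Prop :=
  forall x_ : I -> X, exists2 D, M D & exists x : X, x_ @ D --> x.

Definition quasi_pseudocompact (I : Type) (M : set (set_system I))
    (X : topologicalType) : Prop :=
  forall O : I -> set X, (forall i, open (O i) /\ O i !=set0) ->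
  exists2 D, M D & exists x : X, Dlimit_point D O x.

(* Main.v *)
Require Import Defs.
From mathcomp Require Import all_boot all_order.
From mathcomp Require Import boolp classical_sets functions filter topology.
Local Open Scope classical_set_scope.

(** Both equivalences are instances of one statement about a class [P] of
    subsets of [X]: every sequence of members of [P] has a [D]-limit point for
    some [D] in [M] if and only if, for every open family [O] indexed by [A]
    whose restriction to each [D] in [M] covers [X], some subfamily
    [{O a | i \in a}] meets every member of [P].  Part (a) is the case of
    singletons, since meeting all of them amounts to covering [X]; part (b) is
    the case of nonempty open sets, since meeting all of them is density.

    The general statement is a duality between sequences and families, and each
    direction is an argument by contradiction.
    - If no [i] works for [O], pick for each [i] a member [F i] of [P] that
      misses every [O a] with [i] in [a].  A [D]-limit point [x] of [F] lies in
      some [O a] with [a] in [D]; then both [a] and the set of the [i] such that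
      [F i] meets [O a] belong to [D], hence they intersect: a contradiction
      ([meeting_subfamily_of_limits]).
    - If [F] has no [D]-limit point for any [D] in [M], let [O a] be the largest
      open set that misses all [F i] with [i] in [a] ([avoiding F a]).  A point
      that is not a [D]-limit has an open neighborhood [U] such that the set of
      the [i] with [F i] meeting [U] is not in [D]; as [D] is an ultrafilter, the
      complement [a] of that set is in [D], and [U] is contained in [O a].  So
      [O] satisfies the covering condition, although by construction [F i] misses
      [O a] whenever [i] is in [a] ([limits_of_meeting_subfamily]). *)

Section Duality.
Context {I : Type} {X : topologicalType}.
Implicit Types (D : set_system I) (M : set (set_system I)).
Implicit Types (F : I -> set X) (O : set I -> set X) (P : set (set X)).

Definition every_sequence_has_limit M P : Prop :=
  forall F, (forall i, P (F i)) ->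
  exists2 D, M D & exists x : X, Dlimit_point D F x.

Definition every_cover_has_meeting_subfamily M P : Prop :=
  forall O, (forall a, (\bigcup_(D in M) D) a -> open (O a)) ->
    (forall D, M D -> cover D O = [set: X]) ->
    exists i : I, forall S, P S ->
      S `&` cover [set a | (\bigcup_(D in M) D) a /\ a i] O !=set0.

(** This is the complement of the closure of the union of the [F i] with [i]
    in [a]. *)
Definition avoiding F (a : set I) : set X :=
  \bigcup_(U in [set U | open U /\ forall i, a i -> F i `&` U = set0]) U.

Lemma avoiding_open F a : open (avoiding F a).
Proof. by apply: bigcup_open => U []. Qed.

Lemma avoidingP F a i : a i -> F i `&` avoiding F a = set0.
Proof.
move=> ai; rewrite -subset0 => y [Fy [U [_ FU0] Uy]].
by rewrite -(FU0 _ ai).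
Qed.

(** Maximality of the ultrafilter enters here: what is not in [D] has its
    complement in [D]. *)
Lemma mem_avoiding_or_limit D F x : UltraFilter D ->
  ~ Dlimit_point D F x -> exists2 a, D a & avoiding F a x.
Proof.
move=> D_ultra /existsNP[U /not_implyP[openU /not_implyP[Ux nDU]]].
exists (~` [set i | F i `&` U !=set0]).
  by case: (in_ultra_setVsetC [set i | F i `&` U !=set0] D_ultra).
by exists U => //; split=> // i /= /set0P/negP/negPn/eqP.
Qed.

Lemma meeting_subfamily_of_limits M P :
    (forall D, M D -> UltraFilter D) ->
  every_sequence_has_limit M P -> every_cover_has_meeting_subfamily M P.
Proof.
move=> M_ultra limP O openO coverO; apply: contrapT => /forallNP no_i.
have /choice[F missF] : forall i, exists S : set X,
    P S /\ ~ (S `&` cover [set a | (\bigcup_(D in M) D) a /\ a i] O !=set0).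
  by move=> i; have /existsNP[S /not_implyP] := no_i i; exists S.
have [D MD [x limx]] := limP F (fun i => (missF i).1).
have D_ultra := M_ultra D MD.
have [a Da Oax] : cover D O x by rewrite coverO.
have Aa : (\bigcup_(D in M) D) a by exists D.
have [i [ai [y [Fiy Oay]]]] :=
  filter_ex (filterI Da (limx (O a) (openO a Aa) Oax)).
by apply: (missF i).2; exists y; split=> //; exists a.
Qed.

Lemma limits_of_meeting_subfamily M P :
    (forall D, M D -> UltraFilter D) ->
  every_cover_has_meeting_subfamily M P -> every_sequence_has_limit M P.
Proof.
move=> M_ultra meetP F PF; apply: contrapT => no_lim.
have cover_avoiding D : M D -> cover D (avoiding F) = [set: X].
  move=> MD; apply/seteqP; split=> // x _.
  have [|a Da ax] := @mem_avoiding_or_limit D F x (M_ultra D MD).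
    by move=> limx; apply: no_lim; exists D => //; exists x.
  by exists a.
have [i meeti] := meetP _ (fun a _ => avoiding_open F a) cover_avoiding.
have [y [Fiy [a [_ ai] ay]]] := meeti _ (PF i).
have : (F i `&` avoiding F a) y by [].
by rewrite avoidingP.
Qed.

Lemma limits_iff_meeting_subfamily M P :
    (forall D, M D -> UltraFilter D) ->
  every_sequence_has_limit M P <-> every_cover_has_meeting_subfamily M P.
Proof.
move=> M_ultra; split.
- exact: meeting_subfamily_of_limits.
- exact: limits_of_meeting_subfamily.
Qed.

Lemma Dlimit_point_singletons D (x_ : I -> X) x : Filter D ->
  Dlimit_point D (fun i => [set x_ i]) x <-> x_ @ D --> x.
Proof.
move=> D_filter; split=> [limx U | cvgx U openU Ux].
- rewrite nbhsE => -[V [openV Vx] VU].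
  change (D (x_ @^-1` U)).
  by apply: (filterS _ (limx V openV Vx)) => i [_ [/= -> /VU]].
- have : D (x_ @^-1` U) by apply: cvgx; exact: open_nbhs_nbhs.
  by apply: filterS => i Uxi; exists (x_ i).
Qed.

Lemma quasi_compact_singletons M : (forall D, M D -> UltraFilter D) ->
  quasi_compact M X <-> every_sequence_has_limit M (range (@set1 X)).
Proof.
move=> M_ultra; split=> [compX F | limX x_].
- move=> singF; have /choice[x_ x_F] : forall i, exists x, [set x] = F i.
    by move=> i; have [x _ Fi] := singF i; exists x.
  have [D MD [x cvgx]] := compX x_.
  exists D => //; exists x; have D_ultra := M_ultra D MD.
  have -> : F = fun i => [set x_ i] by apply/funext => i; rewrite x_F.
  exact/Dlimit_point_singletons.
- have [i|D MD [x limx]] := limX (fun i => [set x_ i]); first by exists (x_ i).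
  exists D => //; exists x; have D_ultra := M_ultra D MD.
  exact/Dlimit_point_singletons.
Qed.

Lemma meets_singletons (C : set X) :
  (forall S, range (@set1 X) S -> S `&` C !=set0) <-> C = [set: X].
Proof.
split=> [meetC | -> _ [x _ <-]]; last by exists x.
apply/seteqP; split=> // x _.
by have [|_ [-> ]] := meetC [set x]; first by exists x.
Qed.

End Duality.

Theorem corollary5p14 (I : Type) (M : set (set_system I))
    (hM : forall D, M D -> UltraFilter D) (X : topologicalType) :
  let A : set (set I) := \bigcup_(D in M) D in
  (quasi_compact M X <->
   forall O : set I -> set X,
     (forall a, A a -> open (O a)) ->
     (forall D, M D -> cover D O = [set: X]) ->
     exists i : I, cover [set a | A a /\ a i] O = [set: X])
  /\
  (quasi_pseudocompact M X <->
   forall O : set I -> set X,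
     (forall a, A a -> open (O a)) ->
     (forall D, M D -> cover D O = [set: X]) ->
     exists i : I, dense (cover [set a | A a /\ a i] O)).
Proof.
move=> A; split.
- rewrite (quasi_compact_singletons _ hM) (limits_iff_meeting_subfamily _ _ hM).
  by split=> meetX O openO coverO; have [i Oi] := meetX O openO coverO;
    exists i; apply/meets_singletons.
- have := limits_iff_meeting_subfamily _ [set S : set X | open S /\ S !=set0] hM.
  move=> [limit_meet meet_limit]; split=> [pseudoX O openO coverO | denseX].
  + have [i Oi] := limit_meet pseudoX O openO coverO.
    by exists i => S S0 openS; exact: Oi.
  + apply: meet_limit => O openO coverO.
    have [i Oi] := denseX O openO coverO.
    by exists i => S [openS S0]; exact: Oi.
Qed.
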